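(* Let $G$ be a simple graph and let $H$ be a neighborhood-minor of $G$. Then the cographic matroid $M(H)^*$ is a g-series minor of $M(G)^*$.
   Context: For a graph $G$, $M(G)$ is its cycle (graphic) matroid on the edge set and $M(G)^*$ its dual (cographic matroid), whose circuits are the minimal edge cuts of $G$. For a vertex $v$, $N_G(v)$ is the set of neighbors of $v$, $N_G[v]=N_G(v)\cup\{v\}$, and $N_G(T)=\bigcup_{v\in T}N_G(v)$. For $\emptyset\ne T\subseteq V$, $G_T$ is the induced subgraph on $T$. Neighborhood-minor: if $V(G)=W\cup W'$ with $W\cap W'=\emptyset$, $W,W'\ne\emptyset$, $H=G_W$, and there is $v\in W$ with $W\cap N_G(W')\subseteq N_H[v]$, then $H$ is a neighborhood-minor of $G$. Series contraction: $M/e$ with $e$ in a $2$-element cocircuit of $M$; coloop contraction: $M/e$ with $e$ a coloop. Binary matroidal retract: for binary $M$ and disjoint $E=\{e_1,\dots,e_s\}$, $E'=\{e'_1,\dots,e'_s\}\subseteq E(M)$, $s\ge1$, such that $E'$ is a circuit of $M$ and for every circuit $C$, every $p\in\{0,\dots,s-1\}$ and indices $i_1,\dots,i_p$: $C\cap E'=\{e'_{i_1},\dots,e'_{i_p}\}$ iff $C\cap E$ equals $\{e_{i_1},\dots,e_{i_p}\}$ or $E-\{e_{i_1},\dots,e_{i_p}\}$; then $M/E'$ is a binary matroidal retract of $M$. A g-series minor of $M$ is a matroid (considered up to isomorphism) obtained from $M$ by a sequence of deletions, series contractions, coloop contractions and binary matroidal retracts.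
   Formalization: In the definition of binary matroidal retract, the left side of the equivalence is also taken up to complement (C∩E' equals the given subset or its complement in E'); as written no retract exists (take C=E', p=0) and the claim fails for the 4-cycle. *)

(* Defs.v *)
From HB Require Import structures.
From mathcomp Require Import all_boot all_order all_algebra.
Set Implicit Arguments.
Unset Strict Implicit.
Unset Printing Implicit Defensive.
From mathcomp Require Import zify.
Import GRing.Theory.

(* The ground set is a subset of an ambient finite type, so that minors of a
   matroid live over the same ambient type. *)
Definition matroid_axioms (T : finType) (E : {set T}) (D : {set {set T}}) : bool :=
  [&& [forall I in D, I \subset E],
      set0 \in D,
      [forall I in D, forall J : {set T}, (J \subset I) ==> (J \in D)]
    & [forall I in D, forall J in D, (#|I| < #|J|) ==>
        [exists x in J :\: I, x |: I \in D]]].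

Record matroid (T : finType) := Matroid {
  ground : {set T};
  indep : {set {set T}};
  matroidP : matroid_axioms ground indep
}.

Section MatroidTheory.
Variable T : finType.
Implicit Types (M : matroid T) (I J X Y B : {set T}).

Lemma matroid_ext M N : ground M = ground N -> indep M = indep N -> M = N.
Proof.
case: M N => [E D p] [E' D' p'] /= eE eD; rewrite -eE -eD in p' *.
by rewrite (eq_irrelevance p p').
Qed.

Lemma indep_sub M I : I \in indep M -> I \subset ground M.
Proof. by case/and4P: (matroidP M) => /forall_inP H _ _ _; apply: H. Qed.

Lemma indep0 M : set0 \in indep M.
Proof. by case/and4P: (matroidP M). Qed.

Lemma indepS M I J : J \subset I -> I \in indep M -> J \in indep M.
Proof.
case/and4P: (matroidP M) => _ _ /forall_inP H _ sJI DI.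
by move/forallP: (H I DI) => /(_ J)/implyP; apply.
Qed.

Lemma indep_aug M I J : I \in indep M -> J \in indep M -> #|I| < #|J| ->
  exists2 x, x \in J :\: I & x |: I \in indep M.
Proof.
case/and4P: (matroidP M) => _ _ _ /forall_inP H DI DJ lt.
by move/forall_inP: (H I DI) => /(_ J DJ)/implyP/(_ lt)/exists_inP.
Qed.

Lemma matroid_axiomsI (E : {set T}) (D : {set {set T}}) :
    (forall I, I \in D -> I \subset E) -> set0 \in D ->
    (forall I J, J \subset I -> I \in D -> J \in D) ->
    (forall I J, I \in D -> J \in D -> #|I| < #|J| ->
      exists2 x, x \in J :\: I & x |: I \in D) ->
  matroid_axioms E D.
Proof.
move=> h1 h2 h3 h4; apply/and4P; split=> //.
- by apply/forall_inP.
- apply/forall_inP=> I DI; apply/forallP=> J; apply/implyP=> s; exact: h3 DI.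
apply/forall_inP=> I DI; apply/forall_inP=> J DJ; apply/implyP=> lt.
by apply/exists_inP; apply: h4.
Qed.

Definition bases M : {set {set T}} :=
  [set B | maxset (fun X => X \in indep M) B].

Definition circuit M C : bool :=
  minset (fun X => (X \subset ground M) && (X \notin indep M)) C.

Lemma disjoint_setUl X Y B :
  [disjoint X :|: Y & B] = [disjoint X & B] && [disjoint Y & B].
Proof. by rewrite -!setI_eq0 setIUl setU_eq0. Qed.

Lemma indep_extend M I J : I \in indep M -> J \in indep M ->
  exists K, [/\ K \in indep M, I \subset K, K \subset I :|: J & #|J| <= #|K|].
Proof.
move=> DI DJ.
have pI : (I \in indep M) && (I \subset I :|: J) by rewrite DI subsetUl.
have [K /maxsetP[/andP[DK sK] maxK] sIK] :=
  maxset_exists (P := fun K => (K \in indep M) && (K \subset I :|: J)) pI.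
exists K; split=> //; rewrite leqNgt; apply/negP=> lt.
have [x /setDP[xJ xK] DxK] := indep_aug DK DJ lt.
have sxK : x |: K \subset I :|: J by rewrite subUset sub1set inE xJ orbT.
have /(_ _ (subsetUr _ _)) := maxK (x |: K).
rewrite DxK sxK => /(_ isT) e.
by rewrite -e setU11 in xK.
Qed.

Lemma basis_indep M B : B \in bases M -> B \in indep M.
Proof. by rewrite inE => /maxsetP[]. Qed.

Lemma basis_max M B I : B \in bases M -> I \in indep M -> #|I| <= #|B|.
Proof.
rewrite inE => /maxsetP[DB maxB] DI.
have [K [DK sBK _ leK]] := indep_extend DB DI.
by rewrite -(maxB K DK sBK).
Qed.

Lemma basis_card M B I : B \in bases M -> I \in indep M -> #|B| <= #|I| ->
  I \in bases M.
Proof.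
move=> bB DI le; rewrite inE; apply/maxsetP; split=> // K DK sIK.
apply/eqP; rewrite eq_sym eqEcard sIK /=.
exact: leq_trans (basis_max bB DK) le.
Qed.

Lemma ex_basis M : exists B, B \in bases M.
Proof.
have [B maxB _] := maxset_exists (indep0 M).
by exists B; rewrite inE.
Qed.

Definition dual_indep M : {set {set T}} :=
  [set I : {set T} | [exists B in bases M, I \subset ground M :\: B]].

Lemma dual_indepP M I :
  reflect (exists2 B, B \in bases M & (I \subset ground M) && [disjoint I & B])
          (I \in dual_indep M).
Proof.
by rewrite inE; apply: (iffP exists_inP) => -[B bB h]; exists B;
  rewrite ?subsetD // -subsetD.
Qed.

Fact dual_axioms M : matroid_axioms (ground M) (dual_indep M).
Proof.
apply: matroid_axiomsI.
- by move=> I /dual_indepP[B _ /andP[]].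
- have [B bB] := ex_basis M; apply/dual_indepP; exists B => //.
  by rewrite sub0set disjoints_subset sub0set.
- move=> I J sJI /dual_indepP[B bB /andP[sI dI]]; apply/dual_indepP; exists B => //.
  by rewrite (subset_trans sJI sI) (disjointWl sJI).
move=> I J /dual_indepP[BI bI /andP[sI dI]] /dual_indepP[BJ bJ /andP[sJ dJ]] lt.
have DBJI : BJ :\: I \in indep M := indepS (subsetDl _ _) (basis_indep bJ).
have [B [DB sB1 sB2 leB]] := indep_extend DBJI (basis_indep bI).
have bB : B \in bases M := basis_card bI DB leB.
have dIB : [disjoint I & B].
  apply: disjointWr sB2 _; rewrite disjoint_sym disjoint_setUl.
  by rewrite [X in _ && X]disjoint_sym dI andbT -setI_eq0 setIDAC -setIDA setDv setI0.
have [/subsetP sJB|] := boolP (J :\: I \subset B); last first.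
  case/subsetPn=> x xJI xB; exists x => //; apply/dual_indepP; exists B => //.
  have [xJ _] := setDP xJI.
  rewrite subUset sub1set (subsetP sJ) // sI /= disjoint_sym disjoints_subset.
  apply/subsetP=> y yB; rewrite !inE negb_or.
  rewrite (contraNneq _ xB) => [|<- //].
  by apply/negP=> yI; move: (disjointFr dIB yI); rewrite yB.
suff : #|B| < #|J :\: I| + #|BJ :\: I|.
  suff le : #|J :\: I| + #|BJ :\: I| <= #|B| by rewrite ltnNge le.
  have d : (J :\: I) :&: (BJ :\: I) = set0.
    apply/eqP; rewrite setI_eq0; apply: disjointWl (subsetDl _ _) _.
    exact: disjointWr (subsetDl _ _) dJ.
  rewrite -cardsUI d cards0 addn0 subset_leq_card // subUset sB1 andbT.
  exact/subsetP.
have le1 : #|B| <= #|BJ| := basis_max bJ DB.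
have : #|BJ :&: I| <= #|I :\: J|.
  apply: subset_leq_card; apply/subsetP=> x /setIP[xB xI].
  by rewrite inE xI andbT; apply/negP=> /(disjointFr dJ); rewrite xB.
have : #|I :\: J| < #|J :\: I|.
  by rewrite -(ltn_add2l #|I :&: J|) cardsID [I :&: J]setIC cardsID.
have := cardsID I BJ; lia.
Qed.

Definition dual M := Matroid (dual_axioms M).

Fact delete_axioms M X :
  matroid_axioms (ground M :\: X) [set I in indep M | [disjoint I & X]].
Proof.
apply: matroid_axiomsI.
- by move=> I; rewrite inE subsetD => /andP[/indep_sub-> ->].
- by rewrite inE indep0 disjoints_subset sub0set.
- move=> I J sJI; rewrite !inE => /andP[DI dI].
  by rewrite (indepS sJI DI) (disjointWl sJI).
move=> I J; rewrite !inE => /andP[DI dI] /andP[DJ dJ] lt.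
have [x xJI Dx] := indep_aug DI DJ lt; exists x => //; rewrite inE Dx /=.
have [xJ _] := setDP xJI.
by rewrite disjoint_setUl dI disjoints1 (disjointFr dJ xJ).
Qed.

Definition delete M X := Matroid (delete_axioms M X).

Definition contract M X := dual (delete (dual M) X).

Definition cocircuit M C : bool := circuit (dual M) C.

Definition coloop M (x : T) : bool := cocircuit M [set x].

Definition binary M : Prop :=
  exists n, exists phi : T -> 'rV['F_2]_n, forall X, X \subset ground M ->
    (X \in indep M) = free [seq phi x | x <- enum X].

Definition matroid_iso M (N : matroid T) : Prop :=
  exists f : T -> T, [/\ {in ground M &, injective f},
    f @: ground M = ground N
    & forall X, X \subset ground M -> (X \in indep M) = (f @: X \in indep N)].

(* With E = {e_1, ..., e_s} and E' = {e'_1, ..., e'_s}, an index set I with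
   #|I| < s plays the role of i_1, ..., i_p with 0 <= p <= s - 1.
   The trace of a circuit on E can only determine its trace on E' up to
   complement, so both sides of the equivalence are taken up to complement.
   By [retract_traceP] this is the same as the implication
   "if C :&: E' = e' @: I then C :&: E is e @: I or E :\: e @: I"; by
   [retract_trace_onesided] the equivalence with only "C :&: E' = e' @: I" on
   the left never holds (C = E' and I = set0 violate it). *)
Definition retract_trace M s (e e' : 'I_s -> T) : Prop :=
  forall (C : {set T}) (I : {set 'I_s}), circuit M C -> #|I| < s ->
    let E := e @: setT in let E' := e' @: setT in
    (C :&: E' = e' @: I \/ C :&: E' = E' :\: e' @: I) <->
    (C :&: E = e @: I \/ C :&: E = E :\: e @: I).

Definition retract_data M s (e e' : 'I_s -> T) : Prop :=
  let E := e @: setT in let E' := e' @: setT in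
  [/\ 0 < s,
      injective e /\ injective e',
      E \subset ground M /\ [disjoint E & E'],
      circuit M E'
    & retract_trace M e e'].

Inductive g_series_steps (M : matroid T) : matroid T -> Prop :=
| gs_refl : g_series_steps M M
| gs_delete N x : g_series_steps M N -> x \in ground N ->
    g_series_steps M (delete N [set x])
| gs_series_contract N x C : g_series_steps M N ->
    cocircuit N C -> #|C| = 2 -> x \in C ->
    g_series_steps M (contract N [set x])
| gs_coloop_contract N x : g_series_steps M N -> coloop N x ->
    g_series_steps M (contract N [set x])
| gs_retract N s (e e' : 'I_s -> T) : g_series_steps M N ->
    binary N -> retract_data N e e' ->
    g_series_steps M (contract N (e' @: setT)).

Definition g_series_minor M N : Prop :=
  exists2 N', g_series_steps M N' & matroid_iso N' N.

Lemma retract_trace_onesided M s (e e' : 'I_s -> T) :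
  0 < s -> [disjoint e @: setT & e' @: setT] -> circuit M (e' @: setT) ->
  ~ (forall (C : {set T}) (I : {set 'I_s}), circuit M C -> #|I| < s ->
      C :&: e' @: setT = e' @: I <->
      (C :&: e @: setT = e @: I \/ C :&: e @: setT = e @: setT :\: e @: I)).
Proof.
move=> s0 dEE' cE' /(_ _ set0 cE'); rewrite cards0 => /(_ s0)[_].
rewrite setIid !imset0 setIC; move: dEE'; rewrite -setI_eq0 => /eqP->.
move=> /(_ (or_introl erefl)) e0.
by have := imset_f e' (in_setT (Ordinal s0)); rewrite e0 inE.
Qed.

Lemma retract_traceP M s (e e' : 'I_s -> T) :
  injective e -> injective e' ->
  [disjoint e @: setT & e' @: setT] -> circuit M (e' @: setT) ->
  retract_trace M e e' <->
  (forall (C : {set T}) (I : {set 'I_s}), circuit M C -> #|I| < s ->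
      C :&: e' @: setT = e' @: I ->
      (C :&: e @: setT = e @: I \/ C :&: e @: setT = e @: setT :\: e @: I)).
Proof.
move=> ie ie' dEE' cE'; split=> [h C I cC ltI eq|h C I cC ltI].
  by apply/(h C I cC ltI); left.
have cpl (f : 'I_s -> T) : injective f -> forall J : {set 'I_s},
    f @: setT :\: f @: J = f @: (~: J).
  move=> fi J; rewrite -setTD; apply/setP=> y; apply/setDP/imsetP.
    case=> /imsetP[i _ ->]; rewrite mem_imset // => iJ.
    by exists i => //; rewrite inE iJ inE.
  by case=> i /setDP[_ iJ] ->; split; [rewrite imset_f | rewrite mem_imset].
have trace (f : 'I_s -> T) : injective f -> exists J : {set 'I_s}, C :&: f @: setT = f @: J.
  move=> fi; exists [set i | f i \in C]; apply/setP=> y; apply/setIP/imsetP.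
    by case=> yC /imsetP[i _ yi]; exists i; rewrite // inE -yi.
  by case=> i; rewrite inE => iC ->; rewrite imset_f.
have [J' eJ'] := trace e' ie'; have [J eJ] := trace e ie.
have inj (f : 'I_s -> T) : injective f -> injective (fun K : {set 'I_s} => f @: K).
  exact: imset_inj.
move=> E E'; rewrite /E /E' !cpl // eJ eJ'.
have JJ' : J = J' \/ J = ~: J'.
  have [ltJ'|geJ'] := ltnP #|J'| s.
    have := h C J' cC ltJ' eJ'; rewrite cpl // eJ.
    by case=> /(inj _ ie) ->; [left|right].
  have J'T : J' = setT.
    by apply/eqP; rewrite eqEcard subsetT cardsT card_ord.
  have sE'C : e' @: setT \subset C by rewrite -J'T -eJ' subsetIl.
  have /minsetP[_ minC] := cC; have /minsetP[pE' _] := cE'.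
  have CE' := minC _ pE' sE'C.
  right; rewrite J'T setCT; apply: (inj _ ie); rewrite /= imset0 -eJ -CE' setIC.
  by apply/eqP; rewrite setI_eq0.
have key : (J' = I \/ J' = ~: I) <-> (J = I \/ J = ~: I).
  case: JJ' => -> //; split=> -[] e1; rewrite ?e1 ?setCK; try by [left|right].
    by right; rewrite -e1 setCK.
  by left; apply: setC_inj.
split=> h'.
  have /key[->|->] : J' = I \/ J' = ~: I by case: h' => /(inj _ ie'); [left|right].
    by left.
  by right.
have /key[->|->] : J = I \/ J = ~: I by case: h' => /(inj _ ie); [left|right].
  by left.
by right.
Qed.

End MatroidTheory.

Record sgraph (V : finType) := SGraph {
  vertices : {set V};
  edges : {set {set V}};
  edgesP : [forall f in edges, (f \subset vertices) && (#|f| == 2)]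
}.

Section Graphs.
Variable V : finType.
Implicit Types (G H : sgraph V) (F : {set {set V}}).

Definition nbhs1 G (v : V) : {set V} := [set u | [set v; u] \in edges G].

Definition closed_nbhs1 G (v : V) : {set V} := v |: nbhs1 G v.

Definition nbhs_set G (S : {set V}) : {set V} := \bigcup_(v in S) nbhs1 G v.

Fact induced_edgesP G (W : {set V}) :
  [forall f in [set f in edges G | f \subset W],
     (f \subset vertices G :&: W) && (#|f| == 2)].
Proof.
apply/forall_inP=> f; rewrite inE => /andP[fG fW].
by have /forall_inP/(_ f fG)/andP[fV ->] := edgesP G; rewrite subsetI fV fW.
Qed.

Definition induced G (W : {set V}) : sgraph V := SGraph (induced_edgesP G W).

Definition neighborhood_minor G H : Prop :=
  exists W W' : {set V},
    [/\ vertices G = W :|: W', [disjoint W & W'], W != set0 /\ W' != set0,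
        H = induced G W
      & exists2 v, v \in W & W :&: nbhs_set G W' \subset closed_nbhs1 H v].

Definition adj F : rel V := fun x y => [set x; y] \in F.

Definition forest F : bool :=
  [forall n : 'I_#|V|.+1, forall s : n.-tuple V,
     ~~ [&& 2 < size s, uniq s & cycle (adj F) s]].

Lemma forestP F :
  reflect (forall s, 2 < size s -> uniq s -> cycle (adj F) s -> False) (forest F).
Proof.
apply: (iffP forallP) => [h s s2 us cs | h n].
  have szs : size s < #|V|.+1 by rewrite ltnS -(card_uniqP us) max_card.
  move/forallP: (h (Ordinal szs)) => /(_ (in_tuple s)) /=.
  by rewrite s2 us cs.
by apply/forallP=> s; apply/negP=> /and3P[]; apply: h.
Qed.

Definition incidence (f : {set V}) : 'rV['F_2]_#|V| :=
  (\row_i (enum_val i \in f)%:R)%R.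

Lemma free_rem (K : fieldType) (vT : vectType K) (A : eqType) (phi : A -> vT)
    (s : seq A) : uniq s ->
  ~~ free (map phi s) -> exists2 x, x \in s & phi x \in <<map phi (rem x s)>>%VS.
Proof.
elim: s => [|a s IHs] /=; first by rewrite nil_free.
case/andP=> as_ us; rewrite free_cons negb_and negbK => /orP[ain|].
  by exists a; rewrite ?mem_head //= eqxx.
case/(IHs us)=> x xs xin; exists x; rewrite ?inE ?xs ?orbT //=.
have ax : a != x by apply: contraNneq as_ => ->.
rewrite (negPf ax).
by apply: (subvP (sub_span _) _ xin) => y yin; rewrite inE yin orbT.
Qed.

Lemma free_mem_span (K : fieldType) (vT : vectType K) (A : finType)
    (phi : A -> vT) (X : {set A}) :
  reflect (forall x, x \in X -> phi x \notin <<map phi (enum (X :\ x))>>%VS)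
          (free [seq phi x | x <- enum X]).
Proof.
apply: (iffP idP) => [fX x xX | h].
  have pX : perm_eq (enum X) (x :: enum (X :\ x)).
    apply: uniq_perm; rewrite /= ?enum_uniq ?mem_enum ?setD11 //.
    by move=> y; rewrite inE !mem_enum !inE; case: eqP => [->|].
  by move: fX; rewrite (perm_free (perm_map phi pX)) /= free_cons => /andP[].
apply/negPn/negP=> /(free_rem (enum_uniq _))[x]; rewrite mem_enum => xX.
apply/negP; apply: contra (h x xX).
suff sp : (<<map phi (rem x (enum X))>> <= <<map phi (enum (X :\ x))>>)%VS.
  exact: (subvP sp).
apply: sub_span => w /mapP[y].
rewrite rem_filter ?enum_uniq // mem_filter mem_enum => /andP[/= yx yX] {w}->.
by apply: map_f; rewrite mem_enum !inE yx.
Qed.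

Lemma free_aug (K : fieldType) (vT : vectType K) (A : finType)
    (phi : A -> vT) (X Y : {set A}) :
  free (map phi (enum X)) -> free (map phi (enum Y)) -> #|X| < #|Y| ->
  exists2 x, x \in Y :\: X & free (map phi (enum (x |: X))).
Proof.
move=> fX fY lt; apply/exists_inP/contraT => nex.
have h y : y \in Y :\: X -> ~~ free (map phi (enum (y |: X))).
  by move=> yYX; apply: contra nex => fy; apply/exists_inP; exists y.
have: (<<map phi (enum Y)>> <= <<map phi (enum X)>>)%VS.
  apply/span_subvP=> w /mapP[y]; rewrite mem_enum => yY {w}->.
  have [yX|yX] := boolP (y \in X); first by rewrite memv_span // map_f ?mem_enum.
  have yYX : y \in Y :\: X by rewrite inE yX.
  have pX : perm_eq (enum (y |: X)) (y :: enum X).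
    apply: uniq_perm; rewrite /= ?enum_uniq ?mem_enum ?yX //.
    by move=> z; rewrite inE !mem_enum !inE.
  have := h y yYX; rewrite (perm_free (perm_map phi pX)) /= free_cons fX andbT.
  by rewrite negbK.
move/dimvS; rewrite (eqP (fX : _ == _)) (eqP (fY : _ == _)) !size_map -!cardE.
by rewrite leqNgt lt.
Qed.

Lemma incidence2 (a b : V) : a != b ->
  incidence [set a; b]
  = (delta_mx 0 (enum_rank a) + delta_mx 0 (enum_rank b))%R.
Proof.
move=> ab; apply/rowP=> i; rewrite !mxE eqxx /= !inE.
rewrite -!(can2_eq (@enum_valK _) (@enum_rankK _)).
have [->|_] := eqVneq (enum_val i) a; first by rewrite (negPf ab) addr0.
by rewrite add0r.
Qed.

Lemma edge2 G F f : F \subset edges G -> f \in F ->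
  exists a b, a != b /\ f = [set a; b].
Proof.
move=> sF /(subsetP sF) fG; have /forall_inP/(_ f fG)/andP[_ /cards2P] := edgesP G.
by case=> a [b [ab ->]]; exists a, b.
Qed.

Lemma forest_free G F : F \subset edges G ->
  forest F = free [seq incidence f | f <- enum F].
Proof.
move=> sF; apply/forestP/free_mem_span => [h f fF | h s].
  have [a [b [ab ef]]] := edge2 sF fF.
  pose A := [set x | connect (adj (F :\ f)) a x].
  pose c : 'cV['F_2]_#|V| := (\col_i (enum_val i \in A)%:R)%R.
  have ev x y : x != y -> (incidence [set x; y] *m c = ((x \in A)%:R + (y \in A)%:R)%:M)%R.
    move=> xy; rewrite incidence2 // mulmxDl -!rowE; apply/matrixP=> i j.
    by rewrite !ord1 !mxE !enum_rankK.
  have [bA|bA] := boolP (b \in A).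
    have := bA; rewrite inE => /connectP[p pp eb]; case: (h (a :: shorten a p)).
    - case/shortenP: pp eb => q pq uq _ /=; case: q pq uq => [|x [|y q]] //=.
        by move=> _ _ ba; rewrite ba eqxx in ab.
      by rewrite /adj => /andP[] + _ _ bx; rewrite -bx !inE -ef eqxx.
    - by case/shortenP: pp eb.
    case/shortenP: pp eb => q pq uq _ /= eb; rewrite rcons_path -eb.
    rewrite {2}/adj setUC -ef fF andbT.
    by apply: sub_path pq => x y; rewrite /adj inE => /andP[].
  apply/negP=> fin.
  pose L := linfun (mulmxr c : 'rV['F_2]_#|V| -> 'M_1).
  have: incidence f \in lker L.
    suff sp : (<<map incidence (enum (F :\ f))>> <= lker L)%VS.
      exact: (subvP sp).
    apply/span_subvP=> w /mapP[g].
    rewrite mem_enum => gF ->; rewrite memv_ker lfunE /=.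
    have gF' : g \in F by move: gF; rewrite inE => /andP[].
    have [x [y [xy eg]]] := edge2 sF gF'.
    rewrite eg ev //; have -> : (x \in A) = (y \in A).
      have gxy : adj (F :\ f) x y by rewrite /adj -eg.
      have gyx : adj (F :\ f) y x by rewrite /adj setUC -eg.
      rewrite !inE; apply/idP/idP => /connect_trans; apply; exact: connect1.
    by case: (y \in A); apply/eqP/matrixP=> i j; rewrite !ord1 !mxE; apply/val_inj.
  rewrite memv_ker lfunE /= ef ev // inE connect0 (negPf bA) addr0.
  move/eqP/matrixP/(_ 0%R 0%R); rewrite !mxE => /(congr1 val).
  by [].
case: s => [|x p] //; case/lastP: p => [|q y] // s2 us.
rewrite /cycle rcons_path last_rcons => /andP[pq].
rewrite {1}/adj => yxF.
have s0 : q != [::] by case: q s2 {us pq}.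
have qF : path (adj (F :\ [set y; x])) x (rcons q y).
  case: q s0 us pq {s2} => // z q _ us /=.
  rewrite rcons_cons in us.
  move=> /andP[xz pz].
  have xs : x \notin z :: rcons q y by case/andP: us.
  have zy : z != y.
    by case/and3P: us => _ + _; apply: contraNneq => ->; rewrite mem_rcons mem_head.
  have noteq a b (zz : V) : [set a; b] = [set y; x] -> x = a \/ x = b.
    move=> /setP/(_ x); rewrite !inE eqxx orbT => /orP[]/eqP->; by [left|right].
  rewrite {1}/adj inE -[_ && (_ \in F)]andbC; apply/andP; split.
    rewrite [_ \in F]xz /= inE; apply/eqP=> /setP/(_ z).
    rewrite !inE eqxx orbT (negPf zy) /= => /esym/eqP zx.
    by rewrite zx mem_head in xs.
  apply: (@sub_in_path _ (predC1 x)) pz.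
    move=> a b; rewrite !inE => ax bx; rewrite /adj !inE => ->; rewrite andbT.
    apply/eqP=> /(noteq a b x)[]e; by rewrite e eqxx in ax bx.
  by apply/allP=> w win /=; apply: contraNneq xs => <-.
have main r w : path (adj (F :\ [set y; x])) w r ->
   (delta_mx 0 (enum_rank w) + delta_mx 0 (enum_rank (last w r)))%R
     \in <<map incidence (enum (F :\ [set y; x]))>>%VS.
  elim: r w => [|u r IHr] w /=.
    move=> _; rewrite -mulr2n -scaler_nat.
    have -> : (2%:R = 0 :> 'F_2)%R by apply/val_inj.
    by rewrite scale0r mem0v.
  case/andP=> wu /IHr ur.
  have wu_ : w != u.
    have := wu; rewrite /adj => wF; apply/eqP=> e; rewrite e in wF.
    have : [set u; u] \in edges G.
      by apply: (subsetP sF); move: wF; rewrite inE => /andP[].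
    move=> uG; have /forall_inP/(_ _ uG)/andP[_] := edgesP G.
    by rewrite setUid cards1.
  have : incidence [set w; u] \in <<map incidence (enum (F :\ [set y; x]))>>%VS.
    by apply: memv_span; apply: map_f; rewrite mem_enum.
  rewrite incidence2 // => /(memvD ur).
  rewrite addrC -addrA [X in (_ + X)%R]addrA -mulr2n -scaler_nat.
  have -> : (2%:R = 0 :> 'F_2)%R by apply/val_inj.
  by rewrite scale0r add0r.
have yx : y != x.
  by move: us => /= /andP[+ _]; apply: contraNneq => ->; rewrite mem_rcons mem_head.
have := h _ yxF; rewrite incidence2 // addrC.
by have := main _ _ qF; rewrite last_rcons => ->.
Qed.

Fact cycle_matroid_axioms G :
  matroid_axioms (edges G) [set F : {set {set V}} | (F \subset edges G) && forest F].
Proof.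
apply: matroid_axiomsI.
- by move=> F; rewrite inE => /andP[].
- rewrite inE sub0set /=; apply/forestP=> -[|x [|y s]] //= _ _.
  by rewrite /adj inE.
- move=> F F' sF'F; rewrite !inE => /andP[sF /forestP fF].
  rewrite (subset_trans sF'F sF); apply/forestP=> s s2 us cs.
  by apply: (fF s s2 us); apply: sub_cycle cs => x y; apply: (subsetP sF'F).
move=> F F'; rewrite !inE => /andP[sF fF] /andP[sF' fF'] lt.
rewrite !(@forest_free G) // in fF fF'.
have [f fF'F ff] := free_aug fF fF' lt; exists f => //.
have sfF : f |: F \subset edges G.
  by rewrite subUset sF sub1set andbT (subsetP sF') //; case/setDP: fF'F.
by rewrite inE sfF (@forest_free G).
Qed.

Definition cycle_matroid G := Matroid (cycle_matroid_axioms G).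

End Graphs.

(* Main.v *)
(** Delete from M(G)* every edge contained in W' together with v: in the graph
    this contracts these edges, so each component of G_{W'} either merges into v
    or becomes a single vertex w outside W.  Every remaining edge outside H then
    joins v or some w to a neighbour u of v in H.  An edge parallel to another
    one (in particular one merged onto vu) is in series with it in the dual and
    is removed by a series contraction.  Once no parallel pair is left, the star
    of w is a bond E' matched with the edges E from v to the neighbours of w,
    and a cut meets E and E' in the same indices or in complementary ones,
    according to whether it leaves v and w together or separates them; so a
    retract removes the star.  What remains is exactly M(H)*. *)
Require Import Defs.
From mathcomp Require Import all_boot all_algebra.

Set Implicit Arguments.
Unset Strict Implicit.
Unset Printing Implicit Defensive.

Import GRing.Theory.

(** * Dual matroids and iterated deletion *)

Section Duality.
Variable T : finType.
Implicit Types (M : matroid T) (B X Y : {set T}).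

Lemma sub_basis M X : X \in indep M -> exists2 B, B \in bases M & X \subset B.
Proof.
by move=> /(maxset_exists (P := fun Y => Y \in indep M))[B mB sXB]; exists B;
  rewrite ?inE.
Qed.

Lemma card_basisC M B B' : B \in bases M -> B' \in bases M ->
  #|ground M :\: B| = #|ground M :\: B'|.
Proof.
move=> bB bB'; have DB := basis_indep bB; have DB' := basis_indep bB'.
rewrite !cardsD (setIidPr (indep_sub DB)) (setIidPr (indep_sub DB')).
by congr (_ - _); apply/eqP; rewrite eqn_leq (basis_max bB DB') (basis_max bB' DB).
Qed.

Lemma dual_indep_basisC M B : B \in bases M -> ground M :\: B \in dual_indep M.
Proof.
move=> bB; apply/dual_indepP; exists B => //.
by rewrite subsetDl -setI_eq0 setIDAC -setIDA setDv setI0 eqxx.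
Qed.

Lemma basisC_dual M B : B \in bases M -> ground M :\: B \in bases (dual M).
Proof.
move=> bB; rewrite inE; apply/maxsetP; split; first exact: dual_indep_basisC.
move=> K /dual_indepP[B' bB' /andP[sK dK]] sBK; apply/eqP.
rewrite eq_sym eqEcard sBK (card_basisC bB bB') subset_leq_card //=.
by rewrite subsetD sK.
Qed.

Lemma dual_basisE M B : B \in bases (dual M) ->
  exists2 B', B' \in bases M & B = ground M :\: B'.
Proof.
rewrite inE => /maxsetP[/dual_indepP[B' bB' sB] maxB]; exists B' => //.
by rewrite (maxB _ (dual_indep_basisC bB')) // subsetD.
Qed.

Lemma dual_dual M : dual (dual M) = M.
Proof.
apply: matroid_ext => //; apply/setP=> X; apply/dual_indepP/idP => [|DX].
  case=> _ /dual_basisE[B bB ->] /andP[/= sX dX].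
  apply: indepS (basis_indep bB); apply/subsetP=> x xX.
  by have := disjointFr dX xX; rewrite inE (subsetP sX) // andbT => /negbFE.
have [B bB sXB] := sub_basis DX.
exists (ground M :\: B); first exact: basisC_dual.
rewrite (indep_sub DX) disjoints_subset setDE setCI setCK.
exact: subset_trans sXB (subsetUr _ _).
Qed.

(** With this, contractions of a cographic matroid are computed by dropping vectors from a
    representation of the graphic one. *)
Lemma contract_dual M X : contract (dual M) X = dual (delete M X).
Proof. by rewrite /contract dual_dual. Qed.

Lemma delete0 M : delete M set0 = M.
Proof.
apply: matroid_ext => /=; first by rewrite setD0.
by apply/setP=> X; rewrite inE disjoint_sym disjoints_subset sub0set andbT.
Qed.

Lemma delete_delete M X Y : delete (delete M X) Y = delete M (X :|: Y).
Proof.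
apply: matroid_ext => /=; first by rewrite setDDl.
apply/setP=> Z; rewrite !inE -andbA; congr (_ && _).
by rewrite ![[disjoint Z & _]]disjoint_sym disjoint_setUl.
Qed.

Lemma g_series_deleteS M N X : X \subset ground N -> g_series_steps M N ->
  g_series_steps M (delete N X).
Proof.
have [n] := ubnP #|X|; elim: n X N => // n IHn X N leX sX MN.
have [->|[x xX]] := set_0Vmem X; first by rewrite delete0.
rewrite -(setD1K xX) -delete_delete; apply: IHn.
- by move: leX; rewrite (cardsD1 x X) xX.
- exact: setSD.
exact: gs_delete (subsetP sX x xX).
Qed.

End Duality.

(** * Matroids given by vectors, and representations of their duals *)

Section VectorMatroid.
Local Open Scope ring_scope.
Variables (K : fieldType) (T : finType).

Lemma span_map_sum (vT : vectType K) (phi : T -> vT) (s : seq T) w : uniq s ->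
  w \in <<map phi s>>%VS -> exists u : T -> K, w = \sum_(x <- s) u x *: phi x.
Proof.
elim: s w => [|x s IHs] w /=.
  by rewrite span_nil memv0 => _ /eqP->; exists (fun=> 0); rewrite big_nil.
case/andP=> xs us; rewrite span_cons => /memv_addP[_ /vlineP[k ->] [z zs ->]].
have [u ->] := IHs z us zs; exists (fun y => if y == x then k else u y).
rewrite big_cons eqxx; congr (_ + _); apply: eq_big_seq => y ys.
by rewrite ifN //; apply: contraNneq xs => <-.
Qed.

Lemma free_sumP (vT : vectType K) (phi : T -> vT) (X : {set T}) :
  reflect (forall u : T -> K, \sum_(x in X) u x *: phi x = 0 ->
             {in X, forall x, u x = 0})
          (free [seq phi x | x <- enum X]).
Proof.
apply: (iffP (free_mem_span _ _)) => [h u su x xX | h x xX].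
  apply/eqP/contraT => ux; case/negP: (h x xX).
  move: su; rewrite (big_setD1 x) //= => /(canRL (addrK _)); rewrite sub0r.
  move/(congr1 (fun z => (u x)^-1 *: z)); rewrite scalerA mulVf // scale1r => ->.
  rewrite memvZ // memvN memv_suml // => y yX; rewrite memvZ // memv_span //.
  by rewrite map_f ?mem_enum.
apply/negP=> /(span_map_sum (enum_uniq _))[u]; rewrite big_enum /= => eu.
have /h /(_ x xX) : \sum_(y in X) (if y == x then -1 else u y) *: phi y = 0.
  rewrite (big_setD1 x) //= eqxx scaleN1r eu addrC; apply/eqP; rewrite subr_eq0.
  by apply/eqP/eq_bigr => y; rewrite !inE => /andP[/negPf->].
by rewrite eqxx => /eqP; rewrite oppr_eq0 oner_eq0.
Qed.

Lemma free_subset (vT : vectType K) (phi : T -> vT) (X Y : {set T}) :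
  Y \subset X -> free (map phi (enum X)) -> free (map phi (enum Y)).
Proof.
move=> sYX /free_sumP h; apply/free_sumP => u su x xY.
have := h (fun y => if y \in Y then u y else 0).
rewrite (bigID (mem Y)) /= [X in _ + X]big1 => [|y /andP[_ /negPf->]]; last first.
  by rewrite scale0r.
rewrite addr0 (eq_bigl (mem Y)) => [|y /=]; last first.
  by rewrite andbC; case: (boolP (y \in Y)) => //= /(subsetP sYX).
rewrite (eq_bigr (fun y => u y *: phi y)) => [/(_ su)|y /= ->] //.
by move/(_ x (subsetP sYX x xY)); rewrite xY.
Qed.

Variable n : nat.
Implicit Types (phi : T -> 'rV[K]_n) (F X : {set T}).

Fact vec_matroid_axioms phi F :
  matroid_axioms F [set X : {set T} | (X \subset F) && free (map phi (enum X))].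
Proof.
apply: matroid_axiomsI.
- by move=> X; rewrite inE => /andP[].
- by rewrite inE sub0set enum_set0 nil_free.
- move=> X Y sYX; rewrite !inE => /andP[sX fX].
  by rewrite (subset_trans sYX sX) (free_subset sYX).
move=> X Y; rewrite !inE => /andP[sX fX] /andP[sY fY] lt.
have [x xYX fx] := free_aug fX fY lt; exists x => //.
by rewrite inE fx subUset sX sub1set andbT (subsetP sY) //; case/setDP: xYX.
Qed.

Definition vec_matroid phi F := Matroid (vec_matroid_axioms phi F).

Lemma eq_vec_matroid phi psi F : {in F, phi =1 psi} ->
  vec_matroid phi F = vec_matroid psi F.
Proof.
move=> e; apply: matroid_ext => //=; apply/setP=> X; rewrite !inE.
case: (boolP (X \subset F)) => //= sX; congr free; apply/eq_in_map => x.
by rewrite mem_enum => /(subsetP sX)/e.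
Qed.

Lemma delete_vec_matroid phi F X :
  delete (vec_matroid phi F) X = vec_matroid phi (F :\: X).
Proof.
apply: matroid_ext => //=; apply/setP=> Y; rewrite !inE subsetD.
by rewrite andbAC.
Qed.

(** Since the double dual is the matroid itself, such a parallel pair is a two-element cocircuit of
    the dual, as a series contraction requires. *)
Lemma vec_parallel_circuit phi F x y : x \in F -> y \in F -> x != y ->
  phi x = phi y -> phi x != 0 -> circuit (vec_matroid phi F) [set x; y].
Proof.
move=> xF yF xy e nz.
have f1 z : z \in [set x; y] -> [set z] \in indep (vec_matroid phi F).
  move=> zxy; rewrite inE sub1set enum_set1 /= seq1_free.
  by case/set2P: zxy => ->; rewrite ?xF ?yF -?e.
apply/minsetP; split=> [|Y /andP[_ DY] sY].
  rewrite subUset !sub1set xF yF inE negb_and; apply/orP; right.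
  apply/negP=> /free_sumP/(_ (fun z => if z == x then 1 else -1)).
  rewrite big_setU1 ?inE //= big_set1 eqxx eq_sym (negPf xy) scale1r scaleN1r e subrr.
  by move=> /(_ erefl x); rewrite !inE eqxx => /(_ isT)/eqP; rewrite oner_eq0.
apply/eqP; rewrite eqEsubset sY; apply: contraR DY => nsY.
have [z zxy zY] := subsetPn nsY.
have [t [txy sYt]] : exists t, t \in [set x; y] /\ Y \subset [set t].
  have [zx|zy] := set2P zxy; [exists y | exists x]; rewrite !inE eqxx ?orbT; split=> //;
  by apply/subsetP=> w wY; have /set2P[ew|ew] := subsetP sY w wY;
     rewrite ew inE //; case/negP: zY; rewrite ?zx ?zy -ew.
exact: indepS sYt (f1 t txy).
Qed.

(** Rows are indexed by all of [T], with zero rows off [F]: the row space is still the span of [phi]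
    on [F], and all subsets share one matrix shape. *)
Definition rows_in phi F : 'M[K]_(#|T|, n) :=
  \matrix_i (if enum_val i \in F then phi (enum_val i) else 0).

Lemma row_rows_in phi F x :
  row (enum_rank x) (rows_in phi F) = if x \in F then phi x else 0.
Proof. by rewrite rowK enum_rankK. Qed.

Lemma span_rows_in phi F w : (w <= rows_in phi F)%MS ->
  w \in <<map phi (enum F)>>%VS.
Proof.
case/submxP=> D ->; rewrite mulmx_sum_row memv_suml // => i _.
rewrite rowK memvZ //; case: ifP => [iF|_]; last exact: mem0v.
by rewrite memv_span // map_f ?mem_enum.
Qed.

Lemma span_mulmx0 phi F w m (c : 'M_(n, m)) : w \in <<map phi (enum F)>>%VS ->
  {in F, forall x, phi x *m c = 0} -> w *m c = 0.
Proof.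
case/(span_map_sum (enum_uniq _))=> u -> h.
by rewrite big_enum mulmx_suml big1 // => x xF; rewrite -scalemxAl h ?scaler0.
Qed.

(** An element of [X] outside the span of [B] could be adjoined to [B], against maximality. *)
Lemma vec_basis_span phi F X B : X \subset F ->
  maxset (fun Y => (Y \in indep (vec_matroid phi F)) && (Y \subset X)) B ->
  {in X, forall x, phi x \in <<map phi (enum B)>>%VS}.
Proof.
move=> sXF /maxsetP[/andP[]]; rewrite inE => /andP[sBF fB] sBX maxB x xX.
have [xB|xB] := boolP (x \in B); first by rewrite memv_span ?map_f ?mem_enum.
apply/negPn/negP => nin.
have sxB : (x |: B) \subset X by rewrite subUset sub1set xX.
have := maxB (x |: B); rewrite inE (subset_trans sxB) // sxB subsetUr andbT.
have pX : perm_eq (enum (x |: B)) (x :: enum B).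
  apply: uniq_perm; rewrite /= ?enum_uniq ?mem_enum ?xB //.
  by move=> z; rewrite inE !mem_enum !inE.
rewrite (perm_free (perm_map phi pX)) /= free_cons nin fB => /(_ isT isT) e.
by rewrite -e setU11 in xB.
Qed.

(* X is independent in the dual iff its complement spans, that is, iff every
   functional vanishing on the complement vanishes. *)
Lemma vec_dual_indepP phi F X :
  reflect (X \subset F /\ forall c : 'cV_n,
             {in F :\: X, forall x, phi x *m c = 0} ->
             {in F, forall x, phi x *m c = 0})
          (X \in dual_indep (vec_matroid phi F)).
Proof.
apply: (iffP (dual_indepP _ _)) => [[B bB /andP[sX dX]]|[sX h]].
  split=> // c hc x xF; apply: (@span_mulmx0 phi B).
    apply: (vec_basis_span (subxx F)) xF.
    move: bB; rewrite inE => mB; apply/maxsetP.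
    case/maxsetP: mB => DB mB; split; first by rewrite DB (indep_sub DB).
    by move=> Y /andP[DY _]; apply: mB.
  move=> y yB; apply: hc; rewrite inE (subsetP (indep_sub (basis_indep bB))) //.
  by rewrite andbT (disjointFl dX).
have p0 : (set0 \in indep (vec_matroid phi F)) && (set0 \subset F :\: X).
  by rewrite indep0 sub0set.
have [B mB _] := maxset_exists
  (P := fun Y => (Y \in indep (vec_matroid phi F)) && (Y \subset F :\: X)) p0.
have sp := vec_basis_span (subsetDl F X) mB.
have /maxsetP[/andP[DB sB] _] := mB.
exists B; last by rewrite sX disjoint_sym; move: sB; rewrite subsetD => /andP[].
rewrite inE; apply/maxsetP; split=> // Y DY sBY; apply/eqP.
rewrite eq_sym eqEsubset sBY; apply/subsetP=> y yY.
have yF : y \in F by apply: (subsetP (indep_sub DY)).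
apply/negPn/negP => yB.
(* The columns of the cokernel matrix are functionals that vanish on [B], hence on its span, which
   contains the vectors of [F :\: X]. By [h] they vanish at [y], so [phi y] lies in the row space of
   [B]. *)
have yspan : phi y \in <<map phi (enum B)>>%VS.
  apply: span_rows_in; rewrite submxE; apply/eqP/rowP=> j.
  have hj : {in F :\: X, forall x, phi x *m col j (cokermx (rows_in phi B)) = 0}.
    move=> x /sp xB; apply: (span_mulmx0 xB) => z zB.
    have := row_rows_in phi B z; rewrite zB => <-.
    by rewrite colE mulmxA -row_mul mulmx_coker row0 mul0mx.
  by have /colP/(_ 0) := h _ hj y yF; rewrite colE mulmxA -colE !mxE.
move: DY; rewrite inE => /andP[_ /free_mem_span/(_ y yY)/negP[]].
apply: (subvP (sub_span _)) yspan => w /mapP[z]; rewrite mem_enum => zB ->.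
rewrite map_f // mem_enum !inE (subsetP sBY) // andbT.
by apply: contraNneq yB => <-.
Qed.

End VectorMatroid.

(** The rows of [cokermx A^T] represent the dual: a combination of them vanishes exactly when its
    coefficient vector lies in the row space of [A^T], that is, has on [F] the form [phi x *m c] and
    is zero elsewhere. A relation supported on [X] is thus a functional vanishing on [F :\: X], as
    in [vec_dual_indepP]. *)
Lemma binary_dual_vec (T : finType) n (phi : T -> 'rV['F_2]_n) (F : {set T}) :
  binary (dual (vec_matroid phi F)).
Proof.
pose A := rows_in phi F; pose R := cokermx A^T.
exists #|T|, (fun x => row (enum_rank x) R) => X /= sX.
have suppE (u : T -> 'F_2) : (\sum_(x in X) u x *: row (enum_rank x) R
    = (\row_i (if enum_val i \in X then u (enum_val i) else 0)) *m R)%R.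
  rewrite mulmx_sum_row big_mkcond (reindex _ (onW_bij _ (@enum_val_bij T))) /=.
  apply: eq_bigr => i _; rewrite mxE enum_valK.
  by case: ifP; rewrite ?scale0r.
have cutE (c : 'cV['F_2]_n) x : x \in F ->
    (c^T *m A^T)%R 0%R (enum_rank x) = (phi x *m c)%R 0%R 0%R.
  move=> xF; rewrite -trmx_mul mxE; have := row_rows_in phi F x; rewrite xF => <-.
  by rewrite -row_mul !mxE.
apply/vec_dual_indepP/free_sumP => [[_ h] u|h].
  rewrite suppE => /eqP; rewrite -submxE => /submxP[D eD] x xX.
  have xF := subsetP sX x xX.
  have ux y : y \in F -> (phi y *m D^T)%R 0%R 0%R = if y \in X then u y else 0%R.
    by move=> yF; rewrite -cutE // trmxK -eD mxE enum_rankK.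
  have hD : {in F :\: X, forall y, phi y *m D^T = 0}%R.
    move=> y /setDP[yF yX]; apply/matrixP=> i j.
    by rewrite !ord1 ux // (negPf yX) mxE.
  by have := ux x xF; rewrite xX (h _ hD) // mxE => <-.
split=> // c hc x xF; have [xX|xX] := boolP (x \in X); last by rewrite hc // inE xX.
apply/matrixP=> i j; rewrite !ord1 [RHS]mxE.
apply: (h (fun x => (phi x *m c)%R 0%R 0%R)) xX; rewrite suppE.
have -> : (\row_k (if enum_val k \in X then (phi (enum_val k) *m c) 0 0 else 0)
    = c^T *m A^T)%R; last by rewrite -mulmxA mulmx_coker mulmx0.
apply/rowP=> k; rewrite mxE -[k in RHS]enum_valK.
have [kF|kF] := boolP (enum_val k \in F); last first.
  rewrite ifN; last by apply: contra kF; apply: (subsetP sX).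
  rewrite -trmx_mul mxE.
  have := row_rows_in phi F (enum_val k); rewrite (negPf kF) => e.
  have : row (enum_rank (enum_val k)) (A *m c)%R = 0%R by rewrite row_mul e mul0mx.
  by move/rowP/(_ 0%R); rewrite !mxE.
rewrite cutE //; case: ifP => // kX.
by rewrite hc ?inE ?kX // mxE.
Qed.

(** * Cuts of contracted graphs and cographic matroids *)

Section Cuts.
Variable V : finType.
Implicit Types (G : sgraph V) (h : V -> V) (f : {set V}) (F X : {set {set V}}).
Implicit Types (S W : {set V}).

(* Contracted graphs keep the edges of G as labels: the edge ab joins h a to h b,
   and is a loop (zero vector) when h a = h b. *)
Definition inc h f : 'rV['F_2]_#|V| :=
  (\sum_(a in f) delta_mx 0 (enum_rank (h a)))%R.

Definition cut h F S : {set {set V}} :=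
  [set f in F | [exists a in f, exists b in f, (h a \in S) && (h b \notin S)]].

Lemma inc2 h a b : a != b ->
  inc h [set a; b] = (delta_mx 0 (enum_rank (h a)) + delta_mx 0 (enum_rank (h b)))%R.
Proof. by move=> ab; rewrite /inc big_setU1 ?inE // big_set1. Qed.

Lemma inc_id f : inc id f = incidence f.
Proof.
apply/rowP=> i; rewrite summxE mxE; have [iF|iF] := boolP (enum_val i \in f).
  rewrite (big_setD1 _ iF) /= big1 => [|a]; first by rewrite mxE enum_valK !eqxx addr0.
  rewrite !inE mxE eqxx => /andP[ai _]; case: eqP => //= e.
  by rewrite e enum_rankK eqxx in ai.
rewrite big1 // => a af; rewrite mxE eqxx; case: eqP => // e.
by rewrite e enum_rankK af in iF.
Qed.

Lemma cut2 h F S a b : ([set a; b] \in cut h F S) =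
  ([set a; b] \in F) && ((h a \in S) != (h b \in S)).
Proof.
rewrite inE; congr (_ && _); apply/exists_inP/idP => [[x xf /exists_inP[y yf]]|].
  by case/set2P: xf => ->; case/set2P: yf => ->; do 2?case: (_ \in S).
case: (boolP (h a \in S)) => aS; case: (boolP (h b \in S)) => bS // _.
  by exists a; rewrite ?set21 //; apply/exists_inP; exists b; rewrite ?set22 ?aS.
by exists b; rewrite ?set22 //; apply/exists_inP; exists a; rewrite ?set21 ?bS.
Qed.

Lemma cut_sub h F S : cut h F S \subset F.
Proof. by apply/subsetP=> f; rewrite inE => /andP[]. Qed.

(** The indicator column of [S] sends an edge ab to the sum of the indicators of [h a] and [h b],
    which is nonzero mod 2 exactly when [S] separates them. *)
Lemma inc_cutE G h F S f : F \subset edges G -> f \in F ->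
  ((inc h f *m \col_i (enum_val i \in S)%:R)%R == 0%R) = (f \notin cut h F S).
Proof.
move=> sF fF; have [a [b [ab ef]]] := edge2 sF fF; move: fF; rewrite ef => fF.
rewrite cut2 fF inc2 // mulmxDl -!rowE /=; apply/eqP/idP.
  move/matrixP/(_ 0%R 0%R); rewrite !mxE !enum_rankK.
  by case: (_ \in S); case: (_ \in S) => // /(congr1 val).
move=> e; apply/matrixP=> i j; rewrite !mxE !enum_rankK.
by move: e; case: (_ \in S); case: (_ \in S) => // _; apply/val_inj.
Qed.

(** Over ['F_2] every functional is the indicator of its support, so the functionals in
    [vec_dual_indepP] are vertex sets and their nonzero positions are cuts. *)
Lemma cut_dual_indepP G h F X : F \subset edges G ->
  reflect (X \subset F /\ forall S, cut h F S \subset X -> cut h F S = set0)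
          (X \in dual_indep (vec_matroid (inc h) F)).
Proof.
move=> sF; apply: (iffP (vec_dual_indepP _ _ _)) => -[sX H]; split=> //.
  move=> S sS; apply/eqP/set0Pn=> -[f fS].
  have fF := subsetP (cut_sub h F S) f fS.
  have /(_ f fF)/eqP : {in F, forall g, inc h g *m \col_i (enum_val i \in S)%:R = 0}%R.
    apply: H => g /setDP[gF gX]; apply/eqP; rewrite (inc_cutE _ _ sF) //.
    by apply: contra gX; apply: (subsetP sS).
  by rewrite (inc_cutE _ _ sF) // fS.
move=> c Hc; pose S := [set x | c (enum_rank x) 0%R != 0%R].
have ec : c = (\col_i (enum_val i \in S)%:R)%R.
  apply/colP=> i; rewrite mxE inE enum_valK.
  by case: (c i 0%R) => -[|[|]] //= lt; apply/val_inj.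
have S0 : cut h F S = set0.
  apply: H; apply/subsetP=> f fS; have fF := subsetP (cut_sub h F S) f fS.
  apply: contraTT fS => fX; rewrite -(inc_cutE _ _ sF) // -ec.
  by apply/eqP/Hc; rewrite inE fX.
by move=> f fF; apply/eqP; rewrite ec (inc_cutE _ _ sF) // S0 inE.
Qed.

(** A dependent set contains a nonempty cut, and that cut is itself dependent, so minimality makes
    them equal. *)
Lemma dual_circuit_cut G h F C : F \subset edges G ->
  circuit (dual (vec_matroid (inc h) F)) C -> exists S, C = cut h F S.
Proof.
move=> sF /minsetP[/andP[/= sC DC] minC].
have [/existsP[S /andP[sS S0]]|] :=
  boolP [exists S, (cut h F S \subset C) && (cut h F S != set0)].
  exists S; rewrite (minC (cut h F S)) //= cut_sub /=.
  apply/(cut_dual_indepP _ _ sF) => -[_ /(_ S (subxx _))/eqP].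
  by rewrite (negPf S0).
move/existsPn=> nS; case/(cut_dual_indepP _ _ sF): DC; split=> // S sS.
by have := nS S; rewrite sS negbK => /eqP.
Qed.

Lemma cut_dual_circuit G h F S : F \subset edges G -> cut h F S != set0 ->
  (forall S', cut h F S' \subset cut h F S -> cut h F S' != set0 ->
     cut h F S \subset cut h F S') ->
  circuit (dual (vec_matroid (inc h) F)) (cut h F S).
Proof.
move=> sF S0 minS; apply/minsetP; split=> [|Y /andP[/= sY DY] sYS].
  rewrite /= cut_sub /=; apply/(cut_dual_indepP _ _ sF) => -[_ /(_ S (subxx _))/eqP].
  by rewrite (negPf S0).
apply/eqP; rewrite eqEsubset sYS /=; apply: contraR DY => nS.
apply/(cut_dual_indepP _ _ sF); split=> // S' sS'; apply/eqP.
apply: contraR nS => S'0.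
exact: subset_trans (minS S' (subset_trans sS' sYS) S'0) sS'.
Qed.

Lemma cycle_matroid_vec G : cycle_matroid G = vec_matroid (inc id) (edges G).
Proof.
apply: matroid_ext => //=; apply/setP=> X; rewrite !inE.
case: (boolP (X \subset _)) => //= sX; rewrite (forest_free sX).
by congr free; apply/eq_map => f; rewrite inc_id.
Qed.

(* Deletion in the dual is contraction in the graph: h sends each vertex to a
   representative of its component in the graph formed by the edges in X. *)
Lemma delete_dual_cycle_matroid G h X : X \subset edges G ->
    (forall a b, connect (adj X) a b -> h a = h b) ->
    (forall a, connect (adj X) a (h a)) ->
  delete (dual (cycle_matroid G)) X = dual (vec_matroid (inc h) (edges G :\: X)).
Proof.
move=> sX hX ha; rewrite cycle_matroid_vec; apply: matroid_ext => //.
(* An edge of [X] has both ends sent to the same vertex by [h], so it never crosses a preimage under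
   [h]. *)
have cutE S : cut h (edges G :\: X) S = cut id (edges G) (h @^-1: S).
  apply/setP=> f; have [fG|fG] := boolP (f \in edges G); last first.
    by rewrite !inE (negPf fG) andbF.
  have [a [b [ab ef]]] := edge2 (subxx _) fG; rewrite ef !cut2 !inE.
  have [fX|//] := boolP ([set a; b] \in X).
  by rewrite (hX a b) ?eqxx ?andbF //; apply: connect1.
apply/setP=> Y; rewrite inE; apply/andP/idP.
  case=> /(cut_dual_indepP _ _ (subxx _))[sY H] dY.
  apply/(cut_dual_indepP _ _ (subsetDl (edges G) X)); split; first by rewrite subsetD sY.
  by move=> S; rewrite cutE; apply: H.
case/(cut_dual_indepP _ _ (subsetDl (edges G) X)); rewrite subsetD => /andP[sY dY] H.
split=> //; apply/(cut_dual_indepP _ _ (subxx _)); split=> // S sS.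
(* The cut of [S] lies in [Y] and so avoids [X]. Hence [S] is a union of components of [X], and [h]
   moves vertices only within components. *)
suff eS : h @^-1: S = S by move: (H S); rewrite cutE eS; apply.
have clS : closed (adj X) S.
  move=> a b abX; have abG : [set a; b] \in edges G by apply: (subsetP sX).
  apply/eqP; apply: contraTT (abX : [set a; b] \in X) => ne.
  have /(subsetP sS)/(disjointFr dY)-> // : [set a; b] \in cut id (edges G) S.
  by rewrite cut2 abG.
by apply/setP=> a; rewrite inE -(closed_connect clS (ha a)).
Qed.

End Cuts.

(** * Removing parallel edges and retracting stars *)

Lemma imset_trace (I T : finType) (e : I -> T) (C : {set T}) (J : {set I}) :
  (forall i, (e i \in C) = (i \in J)) -> C :&: e @: setT = e @: J.
Proof.
move=> h; apply/setP=> y; apply/setIP/imsetP => [[yC /imsetP[i _ yi]]|[i iJ ->]].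
  by exists i; rewrite // -h -yi.
by rewrite h iJ imset_f.
Qed.

Lemma imsetC (I T : finType) (e : I -> T) (J : {set I}) : injective e ->
  e @: (~: J) = e @: setT :\: e @: J.
Proof.
move=> ie; apply/setP=> y; apply/imsetP/setDP => [[i iJ ->]|[/imsetP[i _ ->]]].
  by rewrite imset_f // mem_imset // -in_setC.
by rewrite mem_imset // => iJ; exists i; rewrite ?inE.
Qed.

Section Reduction.
Variables (V : finType) (G : sgraph V) (h : V -> V) (W : {set V}) (v : V).
Hypotheses (hW : {in W, forall x, h x = x}) (vW : v \in W).
Implicit Types (f : {set V}) (F X : {set {set V}}) (S : {set V}).

(** Injectivity of [inc h] on the star makes the ends in [W] distinct, so the star edge ending at
    [u] can be paired with the chord from [v] to [u]. As [h] fixes [W], a cut contains the former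
    when it separates [w] from [u], and the latter when it separates [v] from [u]. *)
Lemma star_retract F w M :
    F \subset edges G -> w \notin W -> cut h F [set w] != set0 ->
    {in cut h F [set w], forall f, exists a u,
       [/\ f = [set a; u], h a = w, u \in W, u != v & [set v; u] \in F]} ->
    {in cut h F [set w] &, injective (inc h)} ->
    g_series_steps M (dual (vec_matroid (inc h) F)) ->
  g_series_steps M (dual (vec_matroid (inc h) (F :\: cut h F [set w]))).
Proof.
set star := cut h F [set w] => sF wW star0 starP inc_inj MF.
have neW u : u \in W -> (u == w) = false.
  by move=> uW; apply: contraNF wW => /eqP <-.
(* A star edge has exactly one end in [W], because [h] fixes [W] and sends the other end to [w]; [v]
   is only a default value. *)
pose tip f := odflt v [pick u in f :&: W].
have tipP f : f \in star -> exists a,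
    [/\ a != tip f, f = [set a; tip f], h a = w, tip f \in W
      & tip f != v /\ [set v; tip f] \in F].
  case/starP=> a [u [ef ha uW uv vuF]]; exists a.
  have aW : a \notin W by apply: contra wW => aW; rewrite -ha hW.
  suff -> : tip f = u by split=> //; apply: contraNneq aW => ->.
  rewrite /tip; case: pickP => [x|/(_ u)]; last by rewrite ef !inE eqxx orbT uW.
  rewrite ef !inE => /andP[/orP[]/eqP-> //] aW'.
  by rewrite aW' in aW.
have tip_inj : {in star &, injective tip}.
  move=> f g fs gs e; apply: inc_inj => //.
  have [a [at_ ef ha _ _]] := tipP f fs; have [b [bt eg hb _ _]] := tipP g gs.
  by rewrite ef eg !inc2 // e ha hb.
have starE f S : f \in star -> (f \in cut h F S) = ((w \in S) != (tip f \in S)).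
  move=> fs; have [a [_ ef ha tW _]] := tipP f fs.
  have fF := subsetP (cut_sub h F [set w]) f fs.
  by rewrite {1}ef cut2 -ef fF ha hW.
have chordE f S : f \in star ->
    ([set v; tip f] \in cut h F S) = ((v \in S) != (tip f \in S)).
  by move=> fs; have [a [_ _ _ tW [_ vF]]] := tipP f fs; rewrite cut2 vF !hW.
pose e' := enum_val : 'I_#|star| -> {set V}.
pose e i := [set v; tip (e' i)].
have e's i : e' i \in star by apply: enum_valP.
have ie' : injective e' by apply: enum_val_inj.
have imE' : e' @: setT = star.
  apply/setP=> f; apply/imsetP/idP => [[i _ ->] //|fs].
  by exists (enum_rank_in fs f); rewrite ?inE // /e' enum_rankK_in.
have ie : injective e.
  move=> i j /setP/(_ (tip (e' i))); rewrite !inE eqxx orbT.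
  have [a [_ _ _ _ [/negPf-> _]]] := tipP _ (e's i).
  by move=> /esym/eqP/(tip_inj _ _ (e's i) (e's j))/ie'.
have chordN f : f \in star -> [set v; tip f] \notin star.
  by move=> fs; rewrite chordE // !inE !neW //; have [a []] := tipP f fs.
have dEE' : [disjoint e @: setT & e' @: setT].
  rewrite imE' disjoints_subset; apply/subsetP=> y /imsetP[i _ ->].
  by rewrite inE chordN.
(* A nonempty cut inside the star misses every chord, so all tips lie on the side of [v]. It
   contains some star edge, so [w] lies on the other side and every star edge crosses. *)
have cstar : circuit (dual (vec_matroid (inc h) F)) star.
  apply: (cut_dual_circuit sF star0) => S sS /set0Pn[g gS].
  have chordS f : f \in star -> (v \in S) = (tip f \in S).
    move=> fs; apply/eqP; have := contra (subsetP sS _) (chordN f fs).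
    by rewrite chordE // negbK.
  apply/subsetP=> f fs; rewrite starE // -chordS //.
  by have gs := subsetP sS g gS; rewrite (chordS g) // -starE.
have -> : dual (vec_matroid (inc h) (F :\: star))
    = contract (dual (vec_matroid (inc h) F)) (e' @: setT).
  by rewrite contract_dual delete_vec_matroid imE'.
apply: (gs_retract (e := e)) MF _ _; first exact: binary_dual_vec.
split=> //; first by rewrite card_gt0.
- split=> //; apply/subsetP=> y /imsetP[i _ ->].
  by have [a [_ _ _ _ [_]]] := tipP _ (e's i).
- by rewrite imE'.
apply/retract_traceP => //; first by rewrite imE'.
move=> C I /(dual_circuit_cut sF)[S ->] _ trI.
have trI' i : (i \in I) = ((w \in S) != (tip (e' i) \in S)).
  by rewrite -starE // -(mem_imset _ _ ie') -trI inE imset_f ?andbT.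
(* Equal traces when [v] and [w] are on the same side of the cut, complementary traces otherwise. *)
have [vw|vw] := eqVneq (v \in S) (w \in S); [left|right; rewrite -imsetC //];
  apply: imset_trace => i; rewrite chordE // ?inE trI' ?vw //.
by move: vw; do 3![case: (_ \in S)].
Qed.

Let EH := [set f in edges G | f \subset W].

(** Induction on the number of edges outside [EH]. The condition on [F] survives each removal
    because the chords it asks for lie in [EH], which is never touched. *)
Lemma reduce_to_induced F M :
    EH \subset F -> F \subset edges G ->
    {in F :\: EH, forall f, exists a u,
       [/\ f = [set a; u], h a = v \/ h a \notin W, u \in W, u != v
         & [set v; u] \in EH]} ->
    g_series_steps M (dual (vec_matroid (inc h) F)) ->
  g_series_steps M (dual (vec_matroid (inc h) EH)).
Proof.
have [n] := ubnP #|F :\: EH|; elim: n F => // n IHn F leF sEH sF FP MF.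
have [F0|/set0Pn[f0 f0F]] := eqVneq (F :\: EH) set0.
  suff <- : F = EH by [].
  by apply/eqP; rewrite eqEsubset sEH andbT -setD_eq0 F0.
have shrink X : X \subset F :\: EH -> X != set0 ->
    g_series_steps M (dual (vec_matroid (inc h) (F :\: X))) ->
    g_series_steps M (dual (vec_matroid (inc h) EH)).
  move=> sX X0; apply: IHn.
  - rewrite (leq_trans _ (leF : #|_| <= n)) // setDDl setUC -setDDl.
    apply: proper_card; rewrite properEneq subsetDl andbT.
    apply: contraNneq X0 => e; rewrite -subset0 -(setDv X) subsetD subxx.
    by move: sX; rewrite -e subsetD => /andP[].
  - rewrite subsetD sEH disjoint_sym.
    by move: sX; rewrite subsetD => /andP[].
  - exact: subset_trans (subsetDl _ _) sF.
  by move=> f /setDP[/setDP[fF _] fE]; apply: FP; rewrite inE fE.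
have edge_ne (f : {set V}) a u : f \in F -> f = [set a; u] -> a != u.
  move=> fF ef; have := edgesP G => /forall_inP/(_ f (subsetP sF f fF))/andP[_].
  by rewrite ef cards2; case: (a != u).
(* A parallel pair with a member [f] outside [EH]: contract [f] in the dual. Its vector is nonzero
   because the cut around its end [u] contains [f]. *)
have [/exists_inP[f fFE /exists_inP[g gF /andP[fg /eqP eq_fg]]]|] :=
    boolP [exists f in F :\: EH, exists g in F, (f != g) && (inc h f == inc h g)].
  have fF : f \in F by case/setDP: fFE.
  apply: (shrink [set f]); rewrite ?sub1set //.
    by apply/set0Pn; exists f; rewrite inE.
  rewrite -delete_vec_matroid -contract_dual.
  apply: gs_series_contract MF _ _ (set21 f g); last by rewrite cards2 fg.
  rewrite /cocircuit dual_dual; apply: vec_parallel_circuit => //.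
  have [a [u [ef ha uW uv vuE]]] := FP f fFE.
  have : f \in cut h F [set u].
    rewrite ef cut2 -ef fF !inE (hW uW) eqxx /= eqb_id.
    by case: ha => [->|]; [rewrite eq_sym | apply: contra => /eqP->].
  apply: contraTneq => inc0; rewrite -(inc_cutE _ _ sF) // inc0.
  by rewrite mul0mx.
move/exists_inPn=> noparallel.
have inj f g : f \in F :\: EH -> g \in F -> inc h f = inc h g -> f = g.
  move=> fF gF e; apply/eqP; have := noparallel f fF.
  by move/exists_inPn/(_ g gF); rewrite e eqxx andbT negbK.
have [a [u [ef0 ha uW uv vuE]]] := FP f0 f0F.
have [f0F' f0E] := setDP f0F.
(* Otherwise [f0] would be parallel to the chord from [v] to [u], hence equal to it and in [EH]. *)
have nav : h a != v.
  apply: contraNneq f0E => hav; suff -> : f0 = [set v; u] by [].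
  apply: inj => //; first exact: (subsetP sEH).
  rewrite ef0 !inc2 ?hav ?(hW vW) //; first by rewrite eq_sym.
  exact: (edge_ne f0).
have haW : h a \notin W by case: ha => // /eqP; rewrite (negPf nav).
(* Edges inside [W] have their ends fixed by [h], so none of them meets [h a], which is outside
   [W]. *)
have starF : cut h F [set h a] \subset F :\: EH.
  apply/subsetP=> f fs; have fF := subsetP (cut_sub _ _ _) f fs.
  rewrite inE fF andbT; apply: contraL fs; rewrite inE => /andP[fG fW].
  have [b [c [bc ef]]] := edge2 sF fF; rewrite ef cut2 negb_and negbK !inE.
  have nW x : x \in f -> (h x == h a) = false.
    move/(subsetP fW)=> xW; rewrite hW //.
    by apply: contraNF haW => /eqP <-.
  by rewrite !nW ?eqxx ?orbT // ef !inE eqxx ?orbT.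
have star0 : cut h F [set h a] != set0.
  apply/set0Pn; exists f0; rewrite ef0 cut2 -ef0 f0F' !inE eqxx (hW uW).
  by apply: contraNN haW => /eqP/esym/eqP <-.
apply: (shrink _ starF star0); apply: star_retract => //.
  move=> f fs; have fFE := subsetP starF f fs.
  have [b [c [ef hb cW cv vcE]]] := FP f fFE; exists b, c; split=> //.
    move: fs; rewrite ef cut2 !inE (hW cW) => /andP[_].
    have -> : (c == h a) = false by apply: contraNF haW => /eqP <-.
    by rewrite eqbF_neg negbK => /eqP.
  exact: (subsetP sEH).
move=> f g fs gs; apply: inj; first exact: (subsetP starF).
by case/setDP: (subsetP starF g gs).
Qed.

End Reduction.

(** * Choice of the contracted edges and of component representatives *)

Theorem theorem5p1 (V : finType) (G H : sgraph V)
  (hGH : neighborhood_minor G H) :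
  g_series_minor (dual (cycle_matroid G)) (dual (cycle_matroid H)).
Proof.
case: hGH => W [W' [eV dW _ eH [v vW nbv]]].
pose X := [set f in edges G | f \subset v |: W'].
have sX : X \subset edges G by apply/subsetP=> f; rewrite inE => /andP[].
have symX : connect_sym (adj X).
  by apply: sym_connect_sym => a b; rewrite /adj setUC.
(* The component of [v] must be represented by [v] itself, so that [h] fixes [W]; any root serves
   for the other components. *)
pose h a := if connect (adj X) v a then v else fingraph.root (adj X) a.
have hX a b : connect (adj X) a b -> h a = h b.
  move=> ab; rewrite /h (same_connect_r symX ab).
  by rewrite (eqP (_ : fingraph.root (adj X) a == fingraph.root (adj X) b)) ?root_connect.
have ha a : connect (adj X) a (h a).
  by rewrite /h; case: ifP => [va|_]; [rewrite symX | apply: connect_root].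
(* No edge of [X] meets [W] outside [v]. *)
have isolated a b : a \in W -> a != v -> connect (adj X) a b -> b = a.
  move=> aW av /connectP[[|c p] //= /andP[+ _] _].
  rewrite /adj inE subUset !sub1set !inE (negPf av) (disjointFr dW aW) /=.
  by rewrite andbF.
have hW : {in W, forall a, h a = a}.
  move=> a aW; have [->|av] := eqVneq a v; first by rewrite /h connect0.
  exact: isolated (ha a).
have hN a : a \notin W -> h a = v \/ h a \notin W.
  move=> aW; have [|haW] := boolP (h a \in W); [left|by right].
  apply/eqP; apply: contraR aW => hav; rewrite (isolated (h a) a) //.
  by rewrite symX.
have eEH : edges H = [set f in edges G | f \subset W] by rewrite eH.
exists (dual (cycle_matroid H)); last first.
  by exists id; split=> //; rewrite ?imset_id // => Y _; rewrite imset_id.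
have -> : cycle_matroid H = vec_matroid (inc h) [set f in edges G | f \subset W].
  rewrite cycle_matroid_vec eEH; apply: eq_vec_matroid => f.
  rewrite inE => /andP[_ fW]; rewrite /inc; apply: eq_bigr => a af.
  by rewrite hW // (subsetP fW).
apply: (reduce_to_induced hW vW (F := edges G :\: X)).
(* An edge inside both [W] and [v |: W'] would be contained in [[set v]], which is too small. *)
- apply/subsetP=> f; rewrite !inE => /andP[fG fW]; rewrite fG andbT /=.
  apply/negP=> fX; have /forall_inP/(_ f fG)/andP[_ /eqP f2] := edgesP G.
  have : #|f| <= #|[set v]|; last by rewrite f2 cards1.
  apply: subset_leq_card; apply/subsetP=> x xf.
  move: (subsetP fX x xf); rewrite !inE => /orP[//|].
  by rewrite (disjointFr dW) // (subsetP fW).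
- exact: subsetDl.
(* An edge neither in [X] nor in [H] has an end [a] in [W'] and an end [b] in [W] other than [v].
   The neighborhood condition then provides the chord from [v] to [b] in [H]. *)
- move=> f; rewrite !inE => /and3P[+ + fG]; rewrite fG /=.
  case/subsetPn=> a af aW /subsetPn[b bf]; rewrite !inE negb_or => /andP[bv bW'].
  have /forall_inP/(_ f fG)/andP[fV /eqP f2] := edgesP G.
  have aW' : a \in W'.
    by move: (subsetP fV a af); rewrite eV inE (negPf aW).
  have bW : b \in W.
    by move: (subsetP fV b bf); rewrite eV inE (negPf bW') orbF.
  have ab : a != b by apply: contraNneq aW => ->.
  have ef : f = [set a; b].
    apply/esym/eqP; rewrite eqEcard f2 cards2 ab andbT.
    by rewrite subUset !sub1set af.
  exists a, b; split=> //; first exact: hN.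
  have : b \in closed_nbhs1 H v.
    apply: (subsetP nbv); rewrite inE bW; apply/bigcupP; exists a => //.
    by rewrite inE -ef.
  by rewrite -eEH !inE (negPf bv).
rewrite -delete_dual_cycle_matroid //.
by apply: g_series_deleteS; last exact: gs_refl.
Qed.
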